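(* There are absolute constants $\epsilon,\gamma>0$ such that there is no $(1-\epsilon)$-approximately maximal-in-distributional-range mechanism for the flexible submodular combinatorial public projects problem with one player in the value oracle model, $\max\{f(S):|S|\le k\}$, achieving a better than $1/m^{\gamma}$-approximation in expectation in the objective function, where $m$ is the size of the ground set. This holds even for non-uniform mechanisms of arbitrary computational complexity, as long as the number of value queries is bounded by $\mathrm{poly}(m)$.
   Context: Flexible submodular combinatorial public projects with one player: given a ground set $[m]=\{1,\dots,m\}$, a cardinality bound $0\le k\le m$, and a normalized ($f(\emptyset)=0$) monotone submodular function $f:2^{[m]}\to\mathbb{R}_+$ accessible only through value queries ($S\mapsto f(S)$), choose a set $S\subseteq[m]$ with $|S|\le k$ so as to maximize $f(S)$. Let $\Omega=\{S\subseteq[m]:|S|\le k\}$. A randomized mechanism (allocation rule) is $(1-\epsilon)$-approximately maximal-in-distributional-range if it fixes a set $\mathcal{R}$ of probability distributions over $\Omega$, in advance and independently of $f$, and on every input $f$ it outputs a random set sampled from a distribution $D^*\in\mathcal{R}$ that $(1-\epsilon)$-approximately maximizes $\mathbf{E}_{S\sim D}[f(S)]$ over all $D\in\mathcal{R}$, i.e. $\mathbf{E}_{S\sim D^*}[f(S)]\ge(1-\epsilon)\sup_{D\in\mathcal{R}}\mathbf{E}_{S\sim D}[f(S)]$. The mechanism achieves a $c$-approximation in expectation if on every input the expected value of $f$ on its output is at least $c\cdot\max\{f(S):|S|\le k\}$. A non-uniform mechanism is a separate fixed mechanism for each input size $m$; the size of its program may depend arbitrarily on $m$. *)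

(* Defs.v *)
From HB Require Import structures.
From mathcomp Require Import all_boot all_order all_algebra.
From mathcomp Require Import all_classical all_reals all_analysis.

Set Implicit Arguments.
Unset Strict Implicit.
Unset Printing Implicit Defensive.

Import Order.TTheory GRing.Theory Num.Theory.

Local Open Scope ring_scope.

Definition valuation (R : realType) (m : nat) (f : {set 'I_m} -> R) : Prop :=
  [/\ f finset.set0 = 0,
      forall A, 0 <= f A,
      forall A B : {set 'I_m}, A \subset B -> f A <= f B
    & forall A B : {set 'I_m}, f (A :|: B) + f (A :&: B) <= f A + f B].

(* The maximum of f over Omega; the default value 0 of the iterated maximum is
   harmless because f is nonnegative and the empty set is always feasible. *)
Definition opt (R : realType) (m k : nat) (f : {set 'I_m} -> R) : R :=
  \big[Num.max/0]_(S : {set 'I_m} | (#|S| <= k)%N) f S.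

Definition is_dist (R : realType) (m k : nat) (D : {ffun {set 'I_m} -> R}) :
    Prop :=
  [/\ forall S, 0 <= D S,
      \sum_S D S = 1
    & forall S : {set 'I_m}, (k < #|S|)%N -> D S = 0].

Definition expect (R : realType) (m : nat) (D : {ffun {set 'I_m} -> R})
    (f : {set 'I_m} -> R) : R :=
  \sum_S D S * f S.

(* A deterministic adaptive value-query algorithm.  The continuation of a query
   is an arbitrary function of the real answer, so nothing but the number of
   queries is limited. *)
Inductive query_tree (R : realType) (m : nat) : Type :=
| Output of {set 'I_m}
| Query of {set 'I_m} & (R -> query_tree R m).

Fixpoint run (R : realType) (m : nat) (t : query_tree R m)
    (f : {set 'I_m} -> R) : {set 'I_m} :=
  match t with
  | Output A => A
  | Query A next => run (next (f A)) f
  end.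

Fixpoint num_queries (R : realType) (m : nat) (t : query_tree R m)
    (f : {set 'I_m} -> R) : nat :=
  match t with
  | Output _ => 0
  | Query A next => (num_queries (next (f A)) f).+1
  end.

(* A randomized mechanism for ground sets of size m draws a random seed from an
   arbitrary probability space, and then runs the deterministic algorithm
   determined by the seed and by the cardinality bound k (k is given
   explicitly, only f is accessed by queries). *)
Record mechanism (R : realType) (m : nat) : Type := Mechanism {
  seed_display : measure_display;
  seed : measurableType seed_display;
  seed_law : probability seed R;
  strategy : nat -> seed -> query_tree R m;
  measurable_output : forall (k : nat) (f : {set 'I_m} -> R) (S : {set 'I_m}),
    (k <= m)%N -> valuation f ->
    measurable [set w : seed | run (strategy k w) f = S]%classic
}.

Arguments Output {R m} _.
Arguments strategy {R m} _ _ _.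

Definition output_dist (R : realType) (m : nat) (M : mechanism R m) (k : nat)
    (f : {set 'I_m} -> R) : {ffun {set 'I_m} -> R} :=
  [ffun S => fine (seed_law M [set w | run (strategy M k w) f = S]%classic)].

(* (1 - eps)-approximately maximal in distributional range.  The range may
   depend on k, as Omega does, but not on f. *)
Definition approx_midr (R : realType) (eps : R) (m : nat) (M : mechanism R m) :
    Prop :=
  forall k : nat, (k <= m)%N ->
  exists rng : set {ffun {set 'I_m} -> R},
    (forall D, rng D -> is_dist k D) /\
    forall f : {set 'I_m} -> R, valuation f ->
      rng (output_dist M k f) /\
      (1 - eps) * sup [set expect D f | D in rng]%classic
        <= expect (output_dist M k f) f.

Definition achieves (R : realType) (c : R) (m : nat) (M : mechanism R m) :
    Prop :=
  forall (k : nat) (f : {set 'I_m} -> R), (k <= m)%N -> valuation f ->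
    c * opt k f <= expect (output_dist M k f) f.

(* The bound holds for every input and every outcome of the coin tosses. *)
Definition poly_queries (R : realType) (M : forall m : nat, mechanism R m) :
    Prop :=
  exists p : {poly nat},
  forall (m k : nat) (f : {set 'I_m} -> R) (w : seed (M m)),
    (k <= m)%N -> valuation f ->
    (num_queries (strategy (M m) k w) f <= p.[m])%N.

(* Main.v *)
(** Let [v(f)] be the expected value of [f] on the output of the mechanism on [f].
A range fixed in advance forces [v(f)] to be almost at least the expectation of
[f] under the output distribution on any other input.  For a ground subset [A]
let [g_A(S) = g(#|S :&: A|)], where [g] behaves like a square root.  Split [A]
at random into [A'] and its rest and replace [g_A] by [f(S) = F(x, y)], where
[x] and [y] count the elements of [S] in the two parts; [F(x, y) = g(x + y)]
unless [x] exceeds [y] by an amount that random splits do not reach on a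
polynomial number of queries, while [F(x, 0)] exceeds [g(x)] by a constant
factor.  So the mechanism cannot tell [f] from [g_A] and [v(f)] is about
[v(g_A)]; but if [v(g_A')] were close to [v(g_A)], then the output distribution
on [g_A'], which lies in the range, would do better on [f] by a constant factor.
Hence some [A'] of about half the size of [A] satisfies
[v(g_A') <= (1 - delta) * v(g_A)].  Iterating this logarithmically many times,
from the whole ground set down to a set of size [k], loses a factor polynomial
in [m], while an approximation guarantee bounds [v] from below at every stage.

The function [f] must have a gap at every scale, since nothing is known about the
sizes of the sets that the mechanism outputs; therefore [F] is a weighted sum of
quadratic gadgets over the scales [T = 4 ^+ j]. *)
Require Import Defs.
From mathcomp Require Import all_boot all_order all_algebra.
From mathcomp Require Import all_classical all_reals all_analysis.
From mathcomp Require Import ring lra zify.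

Set Implicit Arguments.
Unset Strict Implicit.
Unset Printing Implicit Defensive.

Import Order.TTheory GRing.Theory Num.Theory.

Local Open Scope ring_scope.

(** * The gadget at one scale *)

Definition hinge (R : realFieldType) (b d : R) : R := Num.max 0 (d - b) ^+ 2.

Lemma hinge_ge0 (R : realFieldType) (b d : R) : 0 <= hinge b d.
Proof. exact: sqr_ge0. Qed.

Lemma hinge_eq0 (R : realFieldType) (b d : R) : d <= b -> hinge b d = 0.
Proof. by move=> h; rewrite /hinge max_l ?expr0n // subr_le0. Qed.

Lemma hinge_le_sqr (R : realFieldType) (b d t : R) : d - b <= t -> hinge b d <= t ^+ 2.
Proof.
move=> h; rewrite /hinge; case: (lerP 0 (d - b)) => h0; last by rewrite expr0n sqr_ge0.
by rewrite ler_sqr ?nnegrE //; apply: le_trans h.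
Qed.

(** The derivative of [hinge b] is 2-Lipschitz, whence the error term [2 * P * Q]. With [P] and [Q]
    the total increments of [x + y], the term [- (x + y) ^+ 2] of the gadget cancels it exactly. *)
Lemma hinge_diff (R : realFieldType) (b d p q P Q : R) :
  `|p| <= P -> `|q| <= Q ->
  hinge b (d + p + q) + hinge b d <= hinge b (d + p) + hinge b (d + q) + 2 * P * Q.
Proof.
wlog qp : p q P Q / q <= p.
  move=> H hp hq; case: (lerP q p) => [/H|/ltW /H]; first exact.
  by move=> /(_ _ _ hq hp); rewrite -!addrA (addrC q p) [_ + (_ + 2 * Q * P)]addrCA mulrAC.
move=> hp hq.
have hPQ : `|p| * `|q| <= P * Q by apply: ler_pM.
set r1 := Num.max 0 (d + p - b); set r2 := Num.max 0 (d + q - b).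
have r10 : 0 <= r1 by rewrite le_max lexx.
have r20 : 0 <= r2 by rewrite le_max lexx.
have r1b : d + p - b <= r1 by rewrite le_max lexx orbT.
have r2b : d + q - b <= r2 by rewrite le_max lexx orbT.
have r21 : r2 <= r1 by rewrite /r2 ge_max r10 (le_trans _ r1b) // lerD2r lerD2l.
have r12 : r1 <= r2 + (p - q).
  by rewrite /r1 ge_max; apply/andP; split; lra.
have e1 : hinge b (d + p) = r1 ^+ 2 by [].
have e2 : hinge b (d + q) = r2 ^+ 2 by [].
have f1 : hinge b (d + p + q) <= (r1 + q) ^+ 2 by apply: hinge_le_sqr; lra.
have f2 : hinge b (d + p + q) <= (r2 + p) ^+ 2 by apply: hinge_le_sqr; lra.
have g1 : hinge b d <= (r2 - q) ^+ 2 by apply: hinge_le_sqr; lra.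
have g2 : hinge b d <= (r1 - p) ^+ 2 by apply: hinge_le_sqr; lra.
rewrite e1 e2.
case: (lerP 0 q) => q0.
  by move: hPQ; rewrite !ger0_norm //; [nra|lra].
move: hPQ; rewrite (ltr0_norm q0); case: (lerP 0 p) => p0.
  rewrite ?(ger0_norm p0) => hPQ.
  case: (lerP (- q) p) => hh; nra.
rewrite ?(ltr0_norm p0) => hPQ; nra.
Qed.

Lemma hinge_tangent (R : realFieldType) (b d p : R) :
  hinge b d + 2 * Num.max 0 (d - b) * p <= hinge b (d + p).
Proof.
set r := Num.max 0 (d - b).
have e : hinge b d = r ^+ 2 by [].
have r0 : 0 <= r by rewrite le_max lexx.
rewrite e /hinge; set s := Num.max _ _.
have s0 : 0 <= s by rewrite le_max lexx.
have sb : d + p - b <= s by rewrite le_max lexx orbT.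
have : r = 0 \/ r = d - b by rewrite /r; case: (lerP 0 (d - b)) => _; [right|left].
case=> er; first by rewrite er expr0n mulr0 mul0r addr0 sqr_ge0.
have h : p <= s - r by rewrite er; lra.
have := mulr_ge0 r0 (_ : 0 <= s - r - p); rewrite subr_ge0 => /(_ h).
by have := sqr_ge0 (s - r); lra.
Qed.

(** Truncating a monotone submodular function at a constant keeps it submodular; this is that fact
    for the four corners of one square. *)
Lemma minr_submod (R : realFieldType) (c q0 q1 q2 q3 : R) :
  q0 <= q1 -> q0 <= q2 -> q1 <= q3 -> q2 <= q3 -> q3 + q0 <= q1 + q2 ->
  Num.min q3 c + Num.min q0 c <= Num.min q1 c + Num.min q2 c.
Proof. by move=> *; rewrite /Num.min; do 4!case: ltP => ?; lra. Qed.

(** With [s = x + y], the quadratic [4 * T * s - s ^+ 2] meets the cap [3 * T ^+ 2] exactly at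
    [s = T]. Its slope there is still [2 * T], which leaves room for a hinge that decreases in
    [y]. *)
Definition gadget (R : realFieldType) (b T x y : R) : R :=
  if x + y <= T then
    Num.min (4 * T * (x + y) - (x + y) ^+ 2 + hinge b (x - y)) (3 * T ^+ 2)
  else 3 * T ^+ 2.

Lemma gadget_le (R : realFieldType) (b T x y : R) : gadget b T x y <= 3 * T ^+ 2.
Proof. by rewrite /gadget; case: ifP => // _; rewrite ge_min lexx orbT. Qed.

Lemma gadget_boundary (R : realFieldType) (b T x y : R) :
  x + y = T -> gadget b T x y = 3 * T ^+ 2.
Proof.
move=> e; rewrite /gadget e lexx; apply/min_idPr.
by have := hinge_ge0 b (x - y); nra.
Qed.

(** Raising [y] lowers the hinge at rate at most [2 * (x + y)], which inside the triangle does not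
    exceed the growth rate [4 * T - 2 * (x + y)] of the quadratic. *)
Lemma gadget_quad_mono (R : realFieldType) (b T x y p q : R) :
  0 <= b -> 0 <= x -> 0 <= y -> 0 <= p -> 0 <= q -> x + p + (y + q) <= T ->
  4 * T * (x + y) - (x + y) ^+ 2 + hinge b (x - y) <=
  4 * T * (x + p + (y + q)) - (x + p + (y + q)) ^+ 2 + hinge b (x + p - (y + q)).
Proof.
move=> b0 x0 y0 p0 q0 hT.
have := hinge_tangent b (x - y) (p - q).
have -> : x - y + (p - q) = x + p - (y + q) by ring.
set r := Num.max _ _ => h.
have r0 : 0 <= r by rewrite le_max lexx.
have rx : r <= x + y by rewrite /r ge_max; apply/andP; split; lra.
set h1 := hinge _ _ in h *; set h2 := hinge _ _ in h *.
have pq : - (2 * (x + y) * (p + q)) <= 2 * r * (p - q).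
  have : - (p + q) <= p - q by lra.
  nra.
have := @mulr_ge0 _ (p + q) (4 * T - 3 * (x + y) - (x + p + (y + q))).
move=> /(_ _ _) H; have := H ltac:(lra) ltac:(lra); nra.
Qed.

Lemma gadget_mono (R : realFieldType) (b T x y p q : R) :
  0 <= b -> 0 <= x -> 0 <= y -> 0 <= p -> 0 <= q ->
  gadget b T x y <= gadget b T (x + p) (y + q).
Proof.
move=> b0 x0 y0 p0 q0; rewrite {2}/gadget; case: ifP => h; last exact: gadget_le.
rewrite le_min gadget_le andbT /gadget ifT; last by lra.
by rewrite ge_min; apply/orP; left; apply: gadget_quad_mono.
Qed.

(* Beyond the triangle x + y <= T the gadget is constant, so it suffices to
   truncate the second increment at the moment when the triangle is left. *)
Lemma gadget_submod (R : realFieldType) (b T x y p q p' q' : R) :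
  0 <= b -> 0 <= x -> 0 <= y -> 0 <= p -> 0 <= q -> 0 <= p' -> 0 <= q' ->
  gadget b T (x + p + p') (y + q + q') + gadget b T x y <=
  gadget b T (x + p) (y + q) + gadget b T (x + p') (y + q').
Proof.
move=> b0 x0 y0 p0 q0.
have inside r s : 0 <= r -> 0 <= s -> x + p + r + (y + q + s) <= T ->
  gadget b T (x + p + r) (y + q + s) + gadget b T x y <=
  gadget b T (x + p) (y + q) + gadget b T (x + r) (y + s).
  move=> r0 s0 hT.
  rewrite /gadget !ifT; [|lra..].
  have m1 := gadget_quad_mono b0 x0 y0 p0 q0 (T := T) ltac:(lra).
  have m2 := gadget_quad_mono b0 x0 y0 r0 s0 (T := T) ltac:(lra).
  have m3 := gadget_quad_mono b0 (addr_ge0 x0 p0) (addr_ge0 y0 q0) r0 s0 hT.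
  have m4 := gadget_quad_mono b0 (addr_ge0 x0 r0) (addr_ge0 y0 s0) p0 q0 (T := T) ltac:(lra).
  rewrite (addrAC x r p) (addrAC y s q) in m4.
  have := @hinge_diff _ b (x - y) (p - q) (r - s) (p + q) (r + s).
  rewrite !ler_norml.
  move=> /(_ ltac:(apply/andP; split; lra) ltac:(apply/andP; split; lra)).
  have -> : x - y + (p - q) + (r - s) = x + p + r - (y + q + s) by ring.
  have -> : x - y + (p - q) = x + p - (y + q) by ring.
  have -> : x - y + (r - s) = x + r - (y + s) by ring.
  move: m1 m2 m3 m4.
  set h0 := hinge b (x - y); set h1 := hinge b (x + p - (y + q)).
  set h2 := hinge b (x + r - (y + s)); set h3 := hinge b (x + p + r - (y + q + s)).
  set M := 3 * T ^+ 2.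
  set Q0 := 4 * T * (x + y) - _ + _.
  set Q1 := 4 * T * (x + p + (y + q)) - _ + _.
  set Q2 := 4 * T * (x + r + (y + s)) - _ + _.
  set Q3 := 4 * T * (x + p + r + (y + q + s)) - _ + _ => m1 m2 m3 m4 hh.
  have dr : Q3 + Q0 <= Q1 + Q2 by rewrite /Q0 /Q1 /Q2 /Q3; nra.
  exact: minr_submod.
move=> p'0 q'0; case: (lerP (x + p + p' + (y + q + q')) T) => hT; first exact: inside.
case: (lerP T (x + p + (y + q))) => hT'.
  have -> : gadget b T (x + p) (y + q) = 3 * T ^+ 2.
    move: hT'; rewrite le_eqVlt => /orP[/eqP/esym|]; first exact: gadget_boundary.
    by rewrite ltNge /gadget => /negbTE ->.
  by apply: lerD; [exact: gadget_le | exact: gadget_mono].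
pose t := (T - (x + p + (y + q))) / (p' + q').
have pq0 : 0 < p' + q' by lra.
have t0 : 0 <= t by apply: divr_ge0; lra.
have t1 : t <= 1 by rewrite ler_pdivrMr //; lra.
have tE : t * (p' + q') = T - (x + p + (y + q)) by rewrite divfK // gt_eqF.
have hB : x + p + t * p' + (y + q + t * q') = T by lra.
have tp : 0 <= t * p' by apply: mulr_ge0.
have tq : 0 <= t * q' by apply: mulr_ge0.
have := inside (t * p') (t * q') tp tq ltac:(by rewrite hB).
rewrite (gadget_boundary b hB) => h1.
have := @gadget_mono _ b T (x + t * p') (y + t * q') ((1 - t) * p') ((1 - t) * q').
have -> : x + t * p' + (1 - t) * p' = x + p' by ring.
have -> : y + t * q' + (1 - t) * q' = y + q' by ring.
move=> /(_ b0 ltac:(lra) ltac:(lra) ltac:(nra) ltac:(nra)) h2.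
have := gadget_le b T (x + p + p') (y + q + q'); lra.
Qed.

Lemma gadget00 (R : realFieldType) (b T : R) : 0 <= b -> 0 <= T -> gadget b T 0 0 = 0.
Proof.
move=> b0 T0; rewrite /gadget addr0 T0 subr0 hinge_eq0 // mulr0 expr0n /= subr0 addr0.
by apply/min_idPl; rewrite mulr_ge0 // sqr_ge0.
Qed.

Lemma gadget_hidden (R : realFieldType) (b T x y : R) :
  0 <= b -> 0 <= x -> 0 <= y -> x <= y + b -> gadget b T x y = gadget b T 0 (x + y).
Proof.
move=> b0 x0 y0 h; rewrite /gadget add0r !hinge_eq0 //; lra.
Qed.

Lemma gadget_linear (R : realFieldType) (b T y : R) :
  0 <= b -> 0 <= T -> 0 <= y -> gadget b T 0 y <= 4 * T * y.
Proof.
move=> b0 T0 y0; rewrite /gadget add0r hinge_eq0; last lra.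
case: ifP => [_|/negbT]; first by rewrite ge_min; apply/orP; left; nra.
by rewrite -ltNge => h; nra.
Qed.

Lemma gadget_swap (R : realFieldType) (b T x : R) :
  0 <= b -> 0 <= x -> gadget b T 0 x <= gadget b T x 0.
Proof.
move=> b0 x0; rewrite /gadget add0r addr0 subr0 (@hinge_eq0 _ b (0 - x)); last lra.
case: ifP => // _; rewrite addr0 le_min !ge_min lexx orbT andbT.
by rewrite lerDl hinge_ge0.
Qed.

(** Up to half of the scale, quadratic plus hinge is at most [4 * T * x <= 2 * T ^+ 2], so the cap
    does not cut off the gain of the hinge. *)
Lemma gadget_gap (R : realFieldType) (b T x : R) :
  0 <= b -> b <= x -> 2 * x <= T ->
  gadget b T 0 x + (x - b) ^+ 2 <= gadget b T x 0.
Proof.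
move=> b0 bx xT; rewrite /gadget add0r addr0 subr0 (@hinge_eq0 _ b (0 - x)); last lra.
have xT' : x <= T by lra.
rewrite xT' /hinge max_r ?subr_ge0 // addr0 le_min; apply/andP; split.
  by rewrite lerD2r ge_min lexx.
have : Num.min (4 * T * x - x ^+ 2) (3 * T ^+ 2) <= 4 * T * x - x ^+ 2 by rewrite ge_min lexx.
nra.
Qed.

(** * Superposition of all scales *)

(** The weights turn the cap at [T = 4 ^+ j] into [3 * 2 ^+ j], three times the square root of [T],
    so that [profile b J 0 x] grows like a square root up to the largest scale. *)
Definition profile (R : realFieldType) (b : R) (J : nat) (x y : R) : R :=
  \sum_(j < J) 8^-1 ^+ j * gadget b (4 ^+ j) x y.

Lemma weight_ge0 (R : realFieldType) (j : nat) : 0 <= 8^-1 ^+ j :> R.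
Proof. by rewrite exprn_ge0 // invr_ge0. Qed.

Lemma profile_mono (R : realFieldType) (b : R) J (x y p q : R) :
  0 <= b -> 0 <= x -> 0 <= y -> 0 <= p -> 0 <= q ->
  profile b J x y <= profile b J (x + p) (y + q).
Proof.
move=> *; apply: ler_sum => j _; rewrite ler_wpM2l ?weight_ge0 //.
exact: gadget_mono.
Qed.

Lemma profile_submod (R : realFieldType) (b : R) J (x y p q p' q' : R) :
  0 <= b -> 0 <= x -> 0 <= y -> 0 <= p -> 0 <= q -> 0 <= p' -> 0 <= q' ->
  profile b J (x + p + p') (y + q + q') + profile b J x y <=
  profile b J (x + p) (y + q) + profile b J (x + p') (y + q').
Proof.
move=> *; rewrite /profile -!big_split /=; apply: ler_sum => j _.
by rewrite -!mulrDr ler_wpM2l ?weight_ge0 //; apply: gadget_submod.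
Qed.

Lemma profile00 (R : realFieldType) (b : R) J : 0 <= b -> profile b J 0 0 = 0.
Proof.
by move=> b0; rewrite /profile big1 // => j _; rewrite gadget00 ?mulr0 // exprn_ge0.
Qed.

Lemma profile_hidden (R : realFieldType) (b : R) J (x y : R) :
  0 <= b -> 0 <= x -> 0 <= y -> x <= y + b -> profile b J x y = profile b J 0 (x + y).
Proof.
by move=> *; apply: eq_bigr => j _; congr (_ * _); apply: gadget_hidden.
Qed.

Lemma profile_swap (R : realFieldType) (b : R) J (x : R) :
  0 <= b -> 0 <= x -> profile b J 0 x <= profile b J x 0.
Proof.
move=> *; apply: ler_sum => j _; rewrite ler_wpM2l ?weight_ge0 //.
exact: gadget_swap.
Qed.

Lemma weight_sqr (R : realFieldType) j : 8^-1 ^+ j * (4 ^+ j) ^+ 2 = 2 ^+ j :> R.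
Proof. by rewrite -exprM mulnC exprM -exprMn; congr (_ ^+ j); field. Qed.

Lemma weight_linear (R : realFieldType) j : 8^-1 ^+ j * 4 ^+ j = 2^-1 ^+ j :> R.
Proof. by rewrite -exprMn; congr (_ ^+ j); field. Qed.

Lemma term_le_sqr (R : realFieldType) (b : R) j (x y : R) :
  8^-1 ^+ j * gadget b (4 ^+ j) x y <= 3 * 2 ^+ j.
Proof.
rewrite -weight_sqr mulrCA ler_wpM2l ?weight_ge0 //; exact: gadget_le.
Qed.

Lemma profile_le (R : realFieldType) (b : R) J (x y : R) :
  profile b J x y <= 3 * 2 ^+ J.
Proof.
elim: J => [|J IH]; first by rewrite /profile big_ord0 expr0; lra.
rewrite /profile big_ord_recr /= exprS -/(profile b J x y).
by have := term_le_sqr b J x y; lra.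
Qed.

(** Scales up to [i] are bounded by their caps, in total [6 * 2 ^+ i]. Larger scales are bounded by
    the linear estimate; their terms [4 * x * 2^-1 ^+ j] form a geometric series of sum at most
    [16 * 2 ^+ i]. *)
Lemma profile_ub (R : realFieldType) (b : R) J i (x : R) :
  0 <= b -> 0 <= x -> x <= 4 ^+ i.+1 -> profile b J 0 x <= 22 * 2 ^+ i.
Proof.
move=> b0 x0 xi.
have pow2 n : 0 <= 2 ^+ n :> R by rewrite exprn_ge0.
case: (leqP J i.+1) => Ji.
  apply: le_trans (profile_le _ _ _ _) _.
  have : 2 ^+ J <= 2 ^+ i.+1 :> R by rewrite ler_eXn2l //; lra.
  by rewrite exprS; have := pow2 i; lra.
rewrite -(subnKC (ltnW Ji)); move: (J - i.+1)%N => n.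
(* The factor [1 - 2^-1 ^+ n] is the partial geometric sum, which makes the induction on [n] go
   through. *)
suff : profile b (i.+1 + n) 0 x <= 6 * 2 ^+ i + 4 * x * 2^-1 ^+ i * (1 - 2^-1 ^+ n).
  have hn : 0 <= 2^-1 ^+ n :> R by rewrite exprn_ge0 // invr_ge0.
  have hx : x * 2^-1 ^+ i <= 4 * 2 ^+ i.
    rewrite exprVn ler_pdivrMr ?exprn_gt0 // -mulrA -expr2 -exprM mulnC exprM.
    by rewrite -natrX -exprS.
  have hx0 : 0 <= x * 2^-1 ^+ i by rewrite mulr_ge0 // exprn_ge0 // invr_ge0.
  have := mulr_ge0 hx0 hn; lra.
elim: n => [|n IH].
  rewrite addn0 expr0 subrr mulr0 addr0; apply: le_trans (profile_le _ _ _ _) _.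
  by rewrite exprS; lra.
rewrite addnS /profile big_ord_recr /= -/(profile b (i.+1 + n) 0 x).
have ht : 8^-1 ^+ (i.+1 + n) * gadget b (4 ^+ (i.+1 + n)) 0 x
    <= 4 * x * (2^-1 ^+ i * 2^-1 ^+ n.+1).
  rewrite -exprD addnS -addSn -weight_linear mulrCA ler_wpM2l ?weight_ge0 //.
  rewrite mulrAC; apply: gadget_linear => //; exact: exprn_ge0.
have e : 2^-1 ^+ n = 2 * 2^-1 ^+ n.+1 :> R by rewrite exprS mulrA divff // mul1r.
by rewrite e in IH; lra.
Qed.

Lemma profile_term (R : realFieldType) (b : R) J j (x y x' y' : R) (e : R) :
  (j < J)%N -> (forall i, gadget b (4 ^+ i) x y <= gadget b (4 ^+ i) x' y') ->
  gadget b (4 ^+ j) x y + e <= gadget b (4 ^+ j) x' y' ->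
  profile b J x y + 8^-1 ^+ j * e <= profile b J x' y'.
Proof.
move=> jJ mon he; rewrite /profile (bigD1 (Ordinal jJ)) //= [leRHS](bigD1 (Ordinal jJ)) //=.
rewrite addrAC -mulrDr; apply: lerD; first by rewrite ler_wpM2l ?weight_ge0.
by apply: ler_sum => i _; rewrite ler_wpM2l ?weight_ge0.
Qed.

(* For [4 ^+ i <= x < 4 ^+ i.+1] the scale [i.+2] alone gains [2 ^+ i / 256] on
   the unbalanced side, while all scales together sum up to at most
   [22 * 2 ^+ i]. *)
Definition gap_ratio (R : realFieldType) : R := (22 * 256)^-1.

Lemma gap_ratio_gt0 (R : realFieldType) : 0 < gap_ratio R.
Proof. by rewrite invr_gt0 mulr_gt0 ?ltr0n. Qed.

Lemma gap_ratio_mul22 (R : realFieldType) : gap_ratio R * 22 = 256^-1.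
Proof. by rewrite /gap_ratio; field. Qed.

Lemma gap_ratio_le (R : realFieldType) : gap_ratio R <= 22^-1.
Proof. by have := gap_ratio_mul22 R; lra. Qed.

Lemma profile_gap (R : realFieldType) (b : R) J i (x : R) :
  0 <= b -> 2 * b <= x -> 4 ^+ i <= x -> x < 4 ^+ i.+1 -> (i.+2 < J)%N ->
  (1 + gap_ratio R) * profile b J 0 x <= profile b J x 0.
Proof.
move=> b0 bx ix xi iJ.
have x0 : 0 <= x by lra.
have := @profile_ub _ b J i x b0 x0 (ltW xi).
have := @profile_term _ b J i.+2 0 x x 0 ((x - b) ^+ 2) iJ.
move=> /(_ (fun j => gadget_swap (4 ^+ j) b0 x0)).
have hT : 2 * x <= 4 ^+ i.+2 by move: xi; rewrite (exprS _ i.+1); lra.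
have bx' : b <= x by lra.
move=> /(_ (@gadget_gap _ b (4 ^+ i.+2) x b0 bx' hT)).
have : 4^-1 * (4 ^+ i) ^+ 2 <= (x - b) ^+ 2.
  rewrite -(_ : (2^-1 * 4 ^+ i) ^+ 2 = 4^-1 * (4 ^+ i) ^+ 2); last first.
    by rewrite exprMn; congr (_ * _); field.
  by rewrite ler_sqr ?nnegrE ?mulr_ge0 ?exprn_ge0 //; lra.
move=> /(ler_wpM2l (weight_ge0 R i.+2)).
have -> : 8^-1 ^+ i.+2 * (4^-1 * (4 ^+ i) ^+ 2) = 256^-1 * 2 ^+ i :> R.
  by rewrite -(weight_sqr R i) (exprS 8^-1 i.+1) (exprS 8^-1 i); field.
move=> h1 h2 /(ler_wpM2l (ltW (gap_ratio_gt0 R))).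
by rewrite mulrA gap_ratio_mul22; lra.
Qed.

(** The gap can fail only for [x] below twice the threshold, where the profile is at most
    [22 * 2 ^+ a]; the additive term pays for those [x]. The gain for [x <= 4 ^ n] may come from
    scale [n + 2], hence [n + 3] scales. *)
Lemma profile_gap_le (R : realFieldType) a n (x : nat) :
  (x <= 4 ^ n)%N ->
  (1 + gap_ratio R) * profile (4 ^+ a) (n + 3) 0 x%:R
    <= profile (4 ^+ a) (n + 3) x%:R 0 + 2^-1 * 2 ^+ a :> R.
Proof.
move=> xn; set b : R := 4 ^+ a; have b0 : 0 <= b by rewrite exprn_ge0.
have x0 : 0 <= x%:R :> R by [].
have a0 : 0 <= 2 ^+ a :> R by rewrite exprn_ge0.
case: (lerP (2 * b) x%:R) => h.
  have x1 : (0 < x)%N by rewrite -(ltr0n R); apply: lt_le_trans h; rewrite mulr_gt0 // exprn_gt0.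
  have /andP[h1 h2] := trunc_log_bounds (isT : 1 < 4)%N x1.
  have hi : (trunc_log 4 x <= n)%N.
    by rewrite -(@leq_exp2l 4) //; apply: leq_trans xn.
  have h1R : 4 ^+ trunc_log 4 x <= x%:R :> R by rewrite -natrX ler_nat.
  have h2R : x%:R < 4 ^+ (trunc_log 4 x).+1 :> R by rewrite -natrX ltr_nat.
  have hJ : ((trunc_log 4 x).+2 < n + 3)%N by rewrite addn3 !ltnS.
  by have := profile_gap b0 h h1R h2R hJ; lra.
have h4 : x%:R <= 4 ^+ a.+1 :> R by rewrite exprS -/b; lra.
have := ler_wpM2l (ltW (gap_ratio_gt0 R)) (@profile_ub _ b (n + 3) a x%:R b0 x0 h4).
rewrite mulrA gap_ratio_mul22.
have := profile_swap (n + 3) b0 x0; lra.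
Qed.

(** Scale [i] alone is at its cap there. *)
Lemma profile_lb (R : realFieldType) (b : R) J i :
  0 <= b -> (i < J)%N -> 3 * 2 ^+ i <= profile b J 0 (4 ^+ i).
Proof.
move=> b0 iJ.
have p4 n : 0 <= 4 ^+ n :> R by rewrite exprn_ge0.
have := @profile_term _ b J i 0 0 0 (4 ^+ i) (3 * (4 ^+ i) ^+ 2) iJ.
rewrite profile00 // add0r gadget00 ?exprn_ge0 // add0r.
rewrite (@gadget_boundary _ _ _ 0 (4 ^+ i)) ?add0r //.
rewrite (mulrCA (8^-1 ^+ i)) weight_sqr; apply=> // j.
by have := @gadget_mono _ b (4 ^+ j) 0 0 0 (4 ^+ i) b0; rewrite !add0r; apply.
Qed.

(** * Valuations with a hidden split of a ground subset *)

Definition hidden_val (R : realType) (b : R) (J m : nat) (A B S : {set 'I_m}) : R :=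
  profile b J #|S :&: A :&: B|%:R #|(S :&: A) :\: B|%:R.

(** Starting from [X :&: Y], the differences [X :\: Y] and [Y :\: X] act as the two increments of
    [profile_submod]. *)
Lemma card_increments (m : nat) (C X Y : {set 'I_m}) :
  [/\ #|X :&: C| = (#|X :&: Y :&: C| + #|(X :\: Y) :&: C|)%N,
      #|Y :&: C| = (#|X :&: Y :&: C| + #|(Y :\: X) :&: C|)%N
    & #|(X :|: Y) :&: C| =
      (#|X :&: Y :&: C| + #|(X :\: Y) :&: C| + #|(Y :\: X) :&: C|)%N].
Proof.
have hX (U V : {set 'I_m}) : #|U :&: C| = (#|U :&: V :&: C| + #|(U :\: V) :&: C|)%N.
  rewrite -(cardsID V (U :&: C)); congr (_ + _)%N; apply: eq_card => e; rewrite !inE.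
    by rewrite andbAC.
  by rewrite andbA.
split; first exact: hX; first by rewrite (hX Y X) (finset.setIC Y X).
rewrite (hX _ X) (_ : (X :|: Y) :&: X = X); last exact/finset.setIidPr/finset.subsetUl.
rewrite (hX X Y); congr (_ + _)%N; apply: eq_card => e; rewrite !inE.
by case: (e \in X).
Qed.

Lemma hidden_val_valuation (R : realType) (b : R) J m (A B : {set 'I_m}) :
  0 <= b -> valuation (hidden_val b J A B).
Proof.
move=> b0.
have mono (X Y : {set 'I_m}) : X \subset Y -> hidden_val b J A B X <= hidden_val b J A B Y.
  move=> XY; rewrite /hidden_val.
  have sub1 : (#|X :&: A :&: B| <= #|Y :&: A :&: B|)%N.
    by rewrite subset_leq_card // !finset.setSI.
  have sub2 : (#|(X :&: A) :\: B| <= #|(Y :&: A) :\: B|)%N.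
    by rewrite subset_leq_card // finset.setSD // finset.setSI.
  by rewrite -(subnKC sub1) -(subnKC sub2) !natrD; apply: profile_mono.
have v0 : hidden_val b J A B finset.set0 = 0.
  by rewrite /hidden_val !finset.set0I finset.set0D cards0 profile00.
split=> //.
  by move=> X; rewrite -v0 mono // finset.sub0set.
move=> X Y; rewrite /hidden_val.
have eD (U : {set 'I_m}) : (U :&: A) :\: B = U :&: (A :\: B).
  by rewrite finset.setIDA.
rewrite !eD -!(finset.setIA _ A B).
have [-> -> ->] := card_increments (A :&: B) X Y.
have [-> -> ->] := card_increments (A :\: B) X Y.
by rewrite !natrD; apply: profile_submod.
Qed.

Lemma hidden_val_hidden (R : realType) (b : R) J m (A B S : {set 'I_m}) :
  0 <= b -> #|S :&: A :&: B|%:R <= #|(S :&: A) :\: B|%:R + b ->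
  hidden_val b J A B S = hidden_val b J A finset.set0 S.
Proof.
move=> b0 h; rewrite /hidden_val profile_hidden // -natrD cardsID.
by rewrite finset.setI0 cards0 finset.setD0.
Qed.

(** * Random splits are balanced *)

Lemma bernoulli_ge (R : realFieldType) (x : R) (n : nat) :
  -1 <= x -> 1 + n%:R * x <= (1 + x) ^+ n.
Proof.
move=> x1; elim: n => [|n IH]; first by rewrite mul0r addr0 expr0.
rewrite exprSr; apply: (@le_trans _ _ ((1 + n%:R * x) * (1 + x))); last first.
  by apply: ler_wpM2r => //; lra.
have := mulr_ge0 (ler0n R n) (sqr_ge0 x); rewrite -natr1; nra.
Qed.

(** The product with [(1 - x) ^+ n] is at most 1, and that factor is at least one half by
    Bernoulli. *)
Lemma expr_half_le2 (R : realFieldType) (n : nat) (x : R) :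
  0 <= x -> n%:R * x = 2^-1 -> (1 + x) ^+ n <= 2.
Proof.
move=> x0 nx; have x1 : x <= 1.
  case: n nx => [|n]; first by rewrite mul0r => /eqP; rewrite eq_sym invr_eq0 pnatr_eq0.
  by rewrite -natr1; have := mulr_ge0 (ler0n R n) x0; lra.
have h : (1 + x) ^+ n * (1 - x) ^+ n <= 1.
  by rewrite -exprMn exprn_ile1 //; nra.
have := @bernoulli_ge R (- x) n ltac:(lra); rewrite mulrN nx => hb.
have := exprn_ge0 n (_ : 0 <= 1 + x); move=> /(_ ltac:(lra)); nra.
Qed.

(** An unnormalized moment generating function of [#|X :&: B| - #|X :\: B|] for uniform [B]. It
    factors over the elements: [r + r^-1] for each one in [X], 2 for each other one. *)
Lemma exp_moment (R : realFieldType) (T : finType) (X : {set T}) (r : R) :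
  r != 0 ->
  \sum_(B : {set T}) r ^+ #|X :&: B| * r^-1 ^+ #|X :\: B|
    = (r + r^-1) ^+ #|X| * 2 ^+ (#|T| - #|X|).
Proof.
move=> r0; pose F i : R := if i \in X then r else 1.
pose G i : R := if i \in X then r^-1 else 1.
transitivity (\prod_i (F i + G i)).
  rewrite bigA_distr; apply: eq_big => // B _.
  rewrite [RHS](bigID (mem B)) /= -!prodr_const; congr (_ * _).
    rewrite [RHS](eq_bigr F); last by move=> i /= ->.
    rewrite [RHS](bigID (mem X)) /= [X in _ = _ * X]big1 ?mulr1; last first.
      by move=> i /andP[_ /negbTE]; rewrite /F => ->.
    apply: eq_big => i; first by rewrite inE andbC.
    by rewrite inE /F => /andP[->].
  rewrite [RHS](eq_bigr G); last by move=> i /= /negbTE ->.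
  rewrite [RHS](bigID (mem X)) /= [X in _ = _ * X]big1 ?mulr1; last first.
    by move=> i /andP[_ /negbTE]; rewrite /G => ->.
  apply: eq_big => i; first by rewrite inE.
  by rewrite inE /G => /andP[_ ->].
rewrite (bigID (mem X)) /=; congr (_ * _).
  by rewrite -prodr_const; apply: eq_bigr => i; rewrite /F /G => ->.
rewrite (eq_bigr (fun=> 2)) => [|i /negbTE]; last by rewrite /F /G => ->.
rewrite prodr_const; congr (_ ^+ _); rewrite -(cardC (mem X)) addKn.
by apply: eq_card => i.
Qed.

Definition unbalanced (T : finType) (b : nat) (X B : {set T}) : bool :=
  (#|X :\: B| + b <= #|X :&: B|)%N.

(** A Chernoff bound with base [r = 1 + N^-1]. The imbalance [N * e] gives the factor
    [r ^+ (N * e) >= 2 ^+ e], while [(r + r^-1) / 2 <= 1 + (2 * N ^+ 2)^-1] raised to a power at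
    most [N ^ 2] stays below 2. *)
Lemma unbalanced_count (R : realFieldType) (T : finType) (N e : nat) (X : {set T}) :
  (0 < N)%N -> (#|T| <= N ^ 2)%N ->
  #|[set B : {set T} | unbalanced (N * e) X B]|%:R * 2 ^+ e <= 2 * 2 ^+ #|T| :> R.
Proof.
move=> N0 TN; have NR : 0 < N%:R :> R by rewrite ltr0n.
pose r : R := 1 + N%:R^-1.
have r1 : 1 < r by rewrite ltrDl invr_gt0.
have r0 : 0 < r by lra.
have re : 2 ^+ e <= r ^+ (N * e).
  rewrite exprM lerXn2r ?nnegrE ?exprn_ge0 ?(ltW r0) //.
  have := @bernoulli_ge R N%:R^-1 N; rewrite divff ?gt_eqF //.
  have N1 : 0 < N%:R^-1 :> R by rewrite invr_gt0.
  by apply; lra.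
have step1 : #|[set B : {set T} | unbalanced (N * e) X B]|%:R * 2 ^+ e
    <= \sum_(B : {set T}) r ^+ #|X :&: B| * r^-1 ^+ #|X :\: B|.
  rewrite -sum1_card natr_sum mulr_suml.
  apply: (@le_trans _ _ (\sum_(B in [set B : {set T} | unbalanced (N * e) X B])
     r ^+ #|X :&: B| * r^-1 ^+ #|X :\: B|)).
    apply: ler_sum => B; rewrite inE /unbalanced => h; rewrite mul1r.
    apply: le_trans re _.
    rewrite exprVn ler_pdivlMr ?exprn_gt0 // -exprD addnC ler_eXn2l //.
  rewrite [leRHS](bigID (mem [set B : {set T} | unbalanced (N * e) X B])) /=.
  by rewrite lerDl sumr_ge0 // => B _; rewrite mulr_ge0 // exprn_ge0 ?invr_ge0 // ltW.
apply: le_trans step1 _; rewrite exp_moment ?gt_eqF //.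
pose x : R := (2 * N%:R ^+ 2)^-1.
have x0 : 0 <= x by rewrite invr_ge0 mulr_ge0 // sqr_ge0.
have hr : r + r^-1 <= 2 * (1 + x).
  rewrite -subr_ge0.
  have -> : 2 * (1 + x) - (r + r^-1) = (N%:R ^+ 2 * (N%:R + 1))^-1.
    rewrite /x /r; field; rewrite !gt_eqF //; lra.
  by rewrite invr_ge0 mulr_ge0 ?sqr_ge0 //; lra.
apply: (@le_trans _ _ ((2 * (1 + x)) ^+ #|X| * 2 ^+ (#|T| - #|X|))).
  rewrite ler_wpM2r ?exprn_ge0 // lerXn2r ?nnegrE //.
    by rewrite addr_ge0 ?invr_ge0 ?(ltW r0).
  by rewrite mulr_ge0 // addr_ge0.
rewrite exprMn mulrAC -exprD subnKC ?max_card // mulrC ler_wpM2r ?exprn_ge0 //.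
apply: (@le_trans _ _ ((1 + x) ^+ (N ^ 2))).
  rewrite ler_weXn2l //; first lra.
  by apply: leq_trans TN; apply: max_card.
apply: expr_half_le2 => //; rewrite natrX /x; field.
by rewrite gt_eqF.
Qed.

(** * Query trees and joint output laws *)

Lemma prob_finite_range (d : measure_display) (T : measurableType d) (R : realType)
    (P : probability T R) (F : finType) (X : T -> F) (s : seq F) :
  (forall t, measurable [set w | X w = t]%classic) -> uniq s ->
  measurable [set w | X w \in s]%classic /\
  fine (P [set w | X w \in s]%classic) = \sum_(t <- s) fine (P [set w | X w = t]%classic).
Proof.
move=> mX; elim: s => [|t s IH] /=.
  move=> _; rewrite big_nil (_ : [set w | X w \in [::]]%classic = set0); last first.
    by apply/seteqP; split => w.
  by rewrite measure0; split; [exact: measurable0|].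
move=> /andP[ts us]; have [ms Es] := IH us.
have -> : [set w | X w \in t :: s]%classic =
    ([set w | X w = t] `|` [set w | X w \in s])%classic.
  apply/seteqP; split => w /=; rewrite inE.
    by case/orP => [/eqP|]; [left|right].
  by case=> [->|->]; rewrite ?eqxx ?orbT.
split; first exact: measurableU.
rewrite big_cons -Es measureU //; last first.
  by apply/seteqP; split => w //= [-> ]; apply/negP.
by rewrite fineD // fin_num_measure.
Qed.

(* Only outputs are measurable, the queries need not be; hence the coupling of
   the runs on different inputs goes through the joint law of finitely many
   outputs. *)
Lemma joint_output_law (R : realType) (m : nat) (M : mechanism R m) (k : nat)
    (I : finType) (f : I -> {set 'I_m} -> R) :
  (k <= m)%N -> (forall i, valuation (f i)) ->
  exists mu : {ffun I -> {set 'I_m}} -> R,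
    [/\ forall t, 0 <= mu t, \sum_t mu t = 1,
        forall t, mu t != 0 -> exists w, forall i, run (strategy M k w) (f i) = t i
      & forall i h, expect (output_dist M k (f i)) h = \sum_t mu t * h (t i)].
Proof.
move=> km vf.
pose X (w : seed M) : {ffun I -> {set 'I_m}} := [ffun i => run (strategy M k w) (f i)].
have mX t : measurable [set w | X w = t]%classic.
  rewrite (_ : [set w | X w = t]%classic =
    (\bigcap_(i in [set: I]) [set w | run (strategy M k w) (f i) = t i])%classic).
    by apply: fin_bigcap_measurable => // i _; exact: measurable_output.
  apply/seteqP; split => w /=; first by move=> <- i _; rewrite /X ffunE.
  by move=> h; apply/ffunP => i; rewrite ffunE h.
exists (fun t => fine (seed_law M [set w | X w = t]%classic)); split.
- by move=> t; rewrite fine_ge0.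
- have [_] := @prob_finite_range _ _ _ (seed_law M) _ X (index_enum _) mX (index_enum_uniq _).
  move=> <-; rewrite (_ : [set w | _]%classic = setT) ?probability_setT //.
  by apply/seteqP; split => w //= _; rewrite mem_index_enum.
- move=> t h; apply/not_existsP => H; move/eqP: h; apply.
  rewrite (_ : [set w | _]%classic = set0) ?measure0 //.
  by apply/seteqP; split => w //= e; apply: (H w) => i; rewrite -e ffunE.
move=> i h; rewrite /expect [RHS](partition_big (fun t : {ffun I -> {set 'I_m}} => t i) xpredT) //=.
apply: eq_bigr => S _.
rewrite (eq_bigr (fun t => fine (seed_law M [set w | X w = t]%classic) * h S)); last first.
  by move=> t /eqP ->.
rewrite -mulr_suml; congr (_ * _); rewrite /output_dist ffunE.
have [_] := @prob_finite_range _ _ _ (seed_law M) _ X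
  [seq t : {ffun I -> {set 'I_m}} <- index_enum _ | t i == S] mX
  (filter_uniq _ (index_enum_uniq _)).
rewrite big_filter => <-; congr (fine (seed_law M _)).
apply/seteqP; split => w /=; rewrite mem_filter mem_index_enum andbT /X ffunE.
  by move=> ->.
by move=> /eqP.
Qed.

(** The output is appended to the queries because two valuations must be compared on it as well. *)
Fixpoint trace (R : realType) (m : nat) (t : query_tree R m) (f : {set 'I_m} -> R) :
    seq {set 'I_m} :=
  match t with
  | Output A => [:: A]
  | Query A next => A :: trace (next (f A)) f
  end.

Lemma size_trace (R : realType) m (t : query_tree R m) f :
  size (trace t f) = (num_queries t f).+1.
Proof. by elim: t => //= A next IH; rewrite IH. Qed.

Lemma run_trace (R : realType) m (t : query_tree R m) f : run t f \in trace t f.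
Proof. by elim: t => [A|A next IH] /=; rewrite inE ?eqxx // IH orbT. Qed.

Lemma run_agree (R : realType) m (t : query_tree R m) f h :
  (forall S, S \in trace t f -> h S = f S) -> run t h = run t f.
Proof.
elim: t => //= A next IH H; rewrite H ?inE ?eqxx //.
by apply: IH => S hS; apply: H; rewrite inE hS orbT.
Qed.

(** * Splitting the ground set *)

Lemma exists_le_average (R : realFieldType) (T : finType) (f : T -> R) (c : R) :
  (0 < #|T|)%N -> \sum_i f i <= c * #|T|%:R -> exists i, f i <= c.
Proof.
move=> T0 h; apply/not_existsP => H.
have lt i : true -> c < f i by move=> _; rewrite ltNge; apply/negP/H.
have /card_gt0P[x0 _] := T0.
have : \sum_(i : T) c < \sum_i f i.
  by apply: ltr_sum => //; apply/hasP; exists x0; rewrite ?mem_index_enum.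
by rewrite sumr_const -mulr_natr ltNge h.
Qed.

(** Averaging over all [B]: each outcome has at most [q.+1] sets whose imbalance can make [B] bad,
    [A] adds one more, and each is unbalanced for at most a fraction [2 / 2 ^+ e] of the [B].
    Bounding the sum of both quantities makes one [B] good for both. *)
Lemma exists_balanced_split (R : realFieldType) (T W : finType) (N e q : nat)
    (A : {set T}) (mu : W -> R) (bad : W -> {set T} -> bool) :
  (0 < N)%N -> (#|T| <= N ^ 2)%N ->
  (forall t, 0 <= mu t) -> \sum_t mu t = 1 ->
  (forall t, mu t != 0 -> exists2 s : seq {set T}, (size s <= q.+1)%N &
     forall B, bad t B -> has (fun X => unbalanced (N * e) X B) s) ->
  exists B, \sum_t mu t * (bad t B)%:R + (unbalanced (N * e) A (~: B))%:R
    <= q.+2%:R * (2 / 2 ^+ e).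
Proof.
move=> N0 TN mu0 mu1 hbad.
have cardS : #|{set T}| = (2 ^ #|T|)%N.
  by rewrite -[in RHS]cardsT -card_powerset powersetT cardsT.
set u : R := 2 / 2 ^+ e * #|{set T}|%:R.
have u0 : 0 <= u by rewrite mulr_ge0 ?divr_ge0 ?exprn_ge0.
have count_unb (X : {set T}) : \sum_B (unbalanced (N * e) X B)%:R <= u.
  have -> : \sum_B (unbalanced (N * e) X B)%:R = #|[set B | unbalanced (N * e) X B]|%:R :> R.
    rewrite -sum1_card natr_sum big_mkcond [RHS]big_mkcond /=; apply: eq_bigr => B _.
    by rewrite inE; case: (unbalanced _ _ _).
  rewrite /u mulrAC ler_pdivlMr ?exprn_gt0 // cardS natrX.
  exact: unbalanced_count.
have count_bad t : mu t * (\sum_B (bad t B)%:R) <= mu t * (q.+1%:R * u).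
  have [->|mt] := eqVneq (mu t) 0; first by rewrite !mul0r.
  rewrite ler_wpM2l //; have [s ss hs] := hbad t mt.
  apply: (@le_trans _ _ (\sum_(X <- s) u)); last first.
    by rewrite big_const_seq count_predT iter_addr_0 -[u *+ _]mulr_natl ler_wpM2r // ler_nat.
  apply: (@le_trans _ _ (\sum_(X <- s) \sum_B (unbalanced (N * e) X B)%:R)).
    rewrite exchange_big /=; apply: ler_sum => B _.
    case: (boolP (bad t B)) => [/hs /hasP[X Xs hX]|_]; last by rewrite sumr_ge0.
    rewrite (big_rem X) //= hX lerDl sumr_ge0 //.
  by apply: ler_sum.
apply: exists_le_average; first by rewrite cardS expn_gt0.
rewrite -mulrA -/u big_split /= exchange_big /=.
have -> : q.+2%:R * u = q.+1%:R * u + u by rewrite -natr1 mulrDl mul1r.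
apply: lerD.
  apply: (@le_trans _ _ (\sum_t mu t * (q.+1%:R * u))).
    by apply: ler_sum => t _; rewrite -mulr_sumr.
  by rewrite -mulr_suml mu1 mul1r.
apply: le_trans (count_unb A).
by rewrite (reindex_inj (inv_inj (@finset.setCK T))) /=; under eq_bigr do rewrite finset.setCK.
Qed.

(** * Comparing output distributions across inputs *)

Lemma expect_le (R : realType) (m k : nat) (D : {ffun {set 'I_m} -> R}) f (c : R) :
  is_dist k D -> (forall S : {set 'I_m}, (#|S| <= k)%N -> f S <= c) -> expect D f <= c.
Proof.
move=> [D0 D1 Dk] h; rewrite -[c]mul1r -D1 /expect mulr_suml; apply: ler_sum => S _.
case: (leqP #|S| k) => Sk; first by rewrite ler_wpM2l // h.
by rewrite Dk // !mul0r.
Qed.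

(** The output distribution on [h] lies in the range, so it competes in the supremum for [f]; that
    supremum is over a set bounded by the value of [f] on the full ground set. *)
Lemma approx_midr_dominates (R : realType) (eps : R) m (M : mechanism R m) (k : nat) :
  eps <= 1 -> approx_midr eps M -> (k <= m)%N ->
  (forall f, valuation f -> is_dist k (output_dist M k f)) /\
  forall f h, valuation f -> valuation h ->
    (1 - eps) * expect (output_dist M k h) f <= expect (output_dist M k f) f.
Proof.
move=> e1 HM km; have [rng [rngD rngP]] := HM k km; split.
  by move=> f vf; apply: rngD; have [] := rngP f vf.
move=> f h vf vh; have [_] := rngP f vf; apply: le_trans.
rewrite ler_wpM2l ?subr_ge0 //; apply: ub_le_sup.
  exists (f [set: 'I_m]%SET) => _ [D /rngD DD <-]; apply: expect_le DD _ => S _.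
  by case: vf => _ _ mono _; apply/mono/finset.subsetT.
by exists (output_dist M k h) => //; have [] := rngP h vh.
Qed.

Lemma opt_ge (R : realType) m k (f : {set 'I_m} -> R) (S : {set 'I_m}) :
  (#|S| <= k)%N -> f S <= opt k f.
Proof. by move=> Sk; rewrite /opt (bigD1 S) //= le_max lexx. Qed.

(** With an empty hidden part this is the function [g_A] of the overview. *)
Definition plain_val (R : realType) (b : R) J m (A : {set 'I_m}) :=
  hidden_val b J A finset.set0.

Lemma plain_valE (R : realType) (b : R) J m (A S : {set 'I_m}) :
  plain_val b J A S = profile b J 0 #|S :&: A|%:R.
Proof. by rewrite /plain_val /hidden_val finset.setI0 cards0 finset.setD0. Qed.

(** The value of the mechanism on the split function is bounded from both sides: from above by [v A]
    plus the cost of detecting the split, from below by what the output distribution on [A'] earns,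
    through [approx_midr_dominates]. The hypotheses make both additive errors at most
    [gap_ratio R / 10] times [v A]. *)
Lemma splitting_step (R : realType) (m k a n N e q : nat) (M : mechanism R m)
    (A : {set 'I_m}) (v := fun X => expect (output_dist M k (plain_val (4 ^+ a) (n + 3) X))
                                     (plain_val (4 ^+ a) (n + 3) X)) :
  approx_midr (gap_ratio R / 10) M -> (k <= m)%N -> (k <= 4 ^ n)%N ->
  (0 < N)%N -> (N * e)%N = (4 ^ a)%N -> (m <= N ^ 2)%N ->
  (forall f w, valuation f -> (num_queries (strategy M k w) f <= q)%N) ->
  q.+2%:R * (2 / 2 ^+ e) < 1 :> R ->
  24 * 2 ^+ n * (q.+2%:R * (2 / 2 ^+ e)) <= (gap_ratio R / 10) * v A ->
  2^-1 * 2 ^+ a <= (gap_ratio R / 10) * v A ->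
  exists2 A' : {set 'I_m}, (#|A| <= 2 * #|A'| + 4 ^ a)%N
    & v A' <= (1 - gap_ratio R / 2) * v A.
Proof.
move=> HM km kn N0 Ne mN hq tau1 err1 err2.
set b : R := 4 ^+ a; have b0 : 0 <= b by rewrite exprn_ge0.
set J := (n + 3)%N; set tau : R := q.+2%:R * _ in tau1 err1.
pose f B := hidden_val b J A B : {set 'I_m} -> R.
have vf B : valuation (f B) by apply: hidden_val_valuation.
have fE S B : ~~ unbalanced (N * e) (S :&: A) B -> f B S = f finset.set0 S.
  rewrite /unbalanced -ltnNge Ne => h; apply: hidden_val_hidden => //.
  by rewrite /b -natrX -natrD ler_nat ltnW.
(* Here [24 = 3 * 2 ^ 3], from the [n + 3] scales. *)
have f_le B S : f B S <= 24 * 2 ^+ n.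
  apply: le_trans (profile_le _ _ _ _) _.
  by rewrite exprD; have := exprn_ge0 n (_ : 0 <= 2 :> R); move=> /(_ ltac:(lra)); lra.
have [mu [mu0 mu1 muw muE]] := joint_output_law M km vf.
(* Outside the bad event both inputs give the same output, and both valuations agree on it. *)
pose bad (t : {ffun {set 'I_m} -> {set 'I_m}}) B :=
  (t B != t finset.set0) || unbalanced (N * e) (t finset.set0 :&: A) B.
have TN : (#|'I_m| <= N ^ 2)%N by rewrite card_ord.
have [t /muw[w hw]|B hB] := exists_balanced_split (bad := bad) (q := q) (e := e) A N0 TN mu0 mu1.
  exists [seq X :&: A | X <- trace (strategy M k w) (f finset.set0)].
    by rewrite size_map size_trace ltnS; apply: hq.
  move=> B; apply: contraLR; rewrite has_map -all_predC => /allP hall.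
  rewrite /bad negb_or; apply/andP; split.
    rewrite negbK -!hw; apply/eqP/run_agree => S /hall; exact: fE.
  by rewrite -hw; apply/hall/run_trace.
exists (A :&: B).
  (* An indicator equal to 1 would exceed the bound [tau < 1]. The complement makes this say that
     [A :&: B] is not much smaller than the rest of [A]. *)
  have : ~~ unbalanced (N * e) A (~: B).
    apply/negP => hu; move: hB; rewrite hu -/tau /=.
    have : 0 <= \sum_t mu t * (bad t B)%:R by rewrite sumr_ge0 // => t _; rewrite mulr_ge0.
    lra.
  rewrite /unbalanced -ltnNge Ne -(cardsID B A) finset.setDE finset.setCK.
  rewrite -finset.setDE; lia.
have eps1 : gap_ratio R / 10 <= 1 by have := gap_ratio_le R; lra.
have hp : \sum_t mu t * (bad t B)%:R <= tau.
  by apply: le_trans hB; rewrite lerDl.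
have [dist dom] := approx_midr_dominates eps1 HM km.
have upper : expect (output_dist M k (f B)) (f B) <= v A + 24 * 2 ^+ n * tau.
  rewrite /v -/(f finset.set0) !muE.
  apply: (@le_trans _ _ (\sum_t mu t * f finset.set0 (t finset.set0)
                         + 24 * 2 ^+ n * \sum_t mu t * (bad t B)%:R)); last first.
    by rewrite lerD2l ler_wpM2l // mulr_ge0 // exprn_ge0.
  rewrite mulr_sumr -big_split /=; apply: ler_sum => t _.
  rewrite mulrCA -mulrDr ler_wpM2l //.
  case: (boolP (bad t B)) => hb.
    rewrite mulr1 ler_wpDl //; by case: (vf finset.set0) => _ + _ _; apply.
  move: hb; rewrite negb_or negbK mulr0 addr0 => /andP[/eqP -> hu].
  by rewrite fE.
have lower : (1 + gap_ratio R) * v (A :&: B) - 2^-1 * 2 ^+ a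
    <= expect (output_dist M k (plain_val b J (A :&: B))) (f B).
  have [D0 D1 Dk] := dist _ (hidden_val_valuation J (A :&: B) finset.set0 b0).
  rewrite /v -/b -/J -/(plain_val b J (A :&: B)) in D0 D1 Dk *.
  move: (output_dist _ _ _) D0 D1 Dk => D D0 D1 Dk.
  have errE : 2^-1 * 2 ^+ a = \sum_S D S * (2^-1 * 2 ^+ a) by rewrite -mulr_suml D1 mul1r.
  rewrite lerBlDr errE /expect mulr_sumr -big_split /=.
  apply: ler_sum => S _; rewrite mulrCA -mulrDr.
  case: (leqP #|S| k) => Sk; last by rewrite Dk // !mul0r.
  rewrite ler_wpM2l // plain_valE /f /hidden_val finset.setIA.
  set x := #|S :&: A :&: B|; set y := #|_ :\: B|.
  have xn : (x <= 4 ^ n)%N.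
    apply: leq_trans kn; apply: leq_trans Sk; rewrite subset_leq_card //.
    by rewrite -finset.setIA finset.subsetIl.
  apply: le_trans (@profile_gap_le R a n x xn) _; rewrite lerD2r.
  (* Elements of [S] in [A] outside [B] can only increase the value, so they may be dropped from the
     lower bound. *)
  have := @profile_mono _ b J x%:R 0 0 y%:R b0; rewrite addr0 add0r; exact.
have := dom _ _ (vf B) (hidden_val_valuation J (A :&: B) finset.set0 b0).
rewrite -/(plain_val b J (A :&: B)).
move: upper lower err1 err2; set L := expect (output_dist M k (plain_val _ _ _)) (f B).
set U := expect _ (f B); rewrite -/tau; set E := 24 * _ * tau; set E' := 2^-1 * _.
have := gap_ratio_le R; have := gap_ratio_gt0 R.
have v0 X : 0 <= v X.
  rewrite /v /expect sumr_ge0 // => S _.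
  have vX := hidden_val_valuation J X finset.set0 b0.
  by have [D0 _ _] := dist _ vX; have [_ f0 _ _] := vX; apply: mulr_ge0; [exact: D0|exact: f0].
move: (v A) (v (A :&: B)) (gap_ratio R) (v0 A) (v0 (A :&: B)) => y x d y0 x0 d0 d1.
move=> upper lower err1 err2 dd.
have h1 : (1 - d / 10) * ((1 + d) * x - d / 10 * y) <= (1 + d / 10) * y.
  have : (1 - d / 10) * ((1 + d) * x - d / 10 * y) <= (1 - d / 10) * L.
    by rewrite ler_wpM2l //; lra.
  by lra.
have dy := mulr_ge0 (ltW d0) y0.
have ddy := mulr_ge0 (ltW d0) dy.
have dx := mulr_ge0 (ltW d0) x0.
have e1 : d * (d * y) <= 22^-1 * (d * y) by rewrite ler_wpM2r.
have e2 : d * (d * x) <= 22^-1 * (d * x) by rewrite ler_wpM2r.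
(* To first order [h1] reads [(1 + 9 / 10 * d) * x <= (1 + d / 5) * y]; the slack absorbs the
   second-order terms since [d <= 22^-1]. *)
have h2 : (1 + 4 / 5 * d) * x <= (1 + 4 / 5 * d) * ((1 - d / 2) * y) by lra.
by rewrite ler_pM2l in h2; lra.
Qed.

(** Let [V] be the profile at [k = 4 ^ n]. The value starts at most at [V] for the full ground set
    and shrinks by the factor [1 - gap_ratio R / 2] in each of [l] splits, yet it stays at least
    [c * V] as long as the current set has [k] elements. *)
Lemma approximation_ratio_le (R : realType) (m a n N e q l : nat) (M : mechanism R m) (c : R) :
  approx_midr (gap_ratio R / 10) M -> achieves c M ->
  (4 ^ n * 4 ^ l <= m)%N -> (2 * 4 ^ a <= 4 ^ n)%N ->
  (0 < N)%N -> (N * e)%N = (4 ^ a)%N -> (m <= N ^ 2)%N ->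
  (forall f w, valuation f -> (num_queries (strategy M (4 ^ n) w) f <= q)%N) ->
  q.+2%:R * (2 / 2 ^+ e) < 1 :> R ->
  8 * (q.+2%:R * (2 / 2 ^+ e)) <= (gap_ratio R / 10) * c ->
  2 ^+ a <= (gap_ratio R / 10) * c * 2 ^+ n ->
  c <= (1 - gap_ratio R / 2) ^+ l.
Proof.
move=> HM Hc mnl an N0 Ne mN hq tau1 err1 err2.
set k := (4 ^ n)%N in hq *; set kap : R := 1 - gap_ratio R / 2.
have km : (k <= m)%N by apply: leq_trans mnl; rewrite leq_pmulr // expn_gt0.
set b : R := 4 ^+ a; have b0 : 0 <= b by rewrite exprn_ge0.
pose v (X : {set 'I_m}) := expect (output_dist M k (plain_val b (n + 3) X)) (plain_val b (n + 3) X).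
pose V := profile b (n + 3) 0 k%:R.
have pn : 0 < 2 ^+ n :> R by rewrite exprn_gt0.
have VB : 3 * 2 ^+ n <= V by rewrite /V /k natrX; apply: profile_lb => //; rewrite addn3 ltnS leqW.
have c0 : 0 <= c.
  have : 0 <= gap_ratio R / 10 * c * 2 ^+ n by apply: le_trans err2; rewrite exprn_ge0.
  by rewrite pmulr_lge0 // pmulr_rge0 // divr_gt0 // gap_ratio_gt0.
have vlow (X : {set 'I_m}) : (k <= #|X|)%N -> c * V <= v X.
  move=> kX; have := Hc k _ km (hidden_val_valuation (n + 3) X finset.set0 b0).
  apply: le_trans; rewrite ler_wpM2l //.
  have [S SX Sk] : exists2 S : {set 'I_m}, S \subset X & #|S| = k.
    have /card_gt0P[S] : (0 < #|[set S : {set 'I_m} | S \subset X & #|S| == k]|)%N.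
      by rewrite cards_draws bin_gt0.
    by rewrite inE => /andP[SX /eqP Sk]; exists S.
  have := @opt_ge R m k (plain_val b (n + 3) X) S ltac:(by rewrite Sk).
  by rewrite plain_valE (finset.setIidPl SX) Sk.
have step : forall i, (i <= l)%N ->
    exists2 X : {set 'I_m}, (m <= #|X| * 4 ^ i)%N & v X <= kap ^+ i * V.
  elim=> [_|i IH il].
    exists [set: 'I_m]%SET; first by rewrite cardsT card_ord muln1.
    rewrite expr0 mul1r.
    have eps1 : gap_ratio R / 10 <= 1 by have := gap_ratio_le R; lra.
    have [dist _] := approx_midr_dominates eps1 HM km.
    have vT := hidden_val_valuation (n + 3) [set: 'I_m]%SET finset.set0 b0.
    apply: expect_le (dist _ vT) _ => S Sk.
    rewrite plain_valE finset.setIT /V -(subnKC Sk) natrD.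
    by have := @profile_mono _ b (n + 3) 0 #|S|%:R 0 (k - #|S|)%:R b0; rewrite addr0; apply.
  have [X mX vX] := IH (ltnW il).
  have kX : (k <= #|X|)%N.
    rewrite -(@leq_pmul2r (4 ^ i)) ?expn_gt0 //; apply: leq_trans mX.
    by apply: leq_trans mnl; rewrite leq_mul2l leq_exp2l // (ltnW il) orbT.
  (* The factor 3 reconciles the 24 in the error bound of [splitting_step] with the 8 assumed
     here. *)
  have vX3 : c * (3 * 2 ^+ n) <= v X.
    by apply: le_trans (vlow X kX); rewrite ler_wpM2l.
  have [||X' XX' vX'] := @splitting_step R m k a n N e q M X HM km (leqnn _) N0 Ne mN hq tau1.
  - rewrite -/b -/(v X); move: err1; set tau := q.+2%:R * _ => err1.
    have {}err1 := ler_wpM2r (ltW pn) err1.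
    have := gap_ratio_gt0 R; move: (gap_ratio R) err1 => d err1 d0.
    have dv : d * (c * (3 * 2 ^+ n)) <= d * v X by rewrite ler_wpM2l // ltW.
    move: dv err1; move: (v X) (2 ^+ n) tau => y p t; clear; lra.
  - rewrite -/b -/(v X); have := gap_ratio_gt0 R; move: (gap_ratio R) err2 => d err2 d0.
    have dv : d * (c * (3 * 2 ^+ n)) <= d * v X by rewrite ler_wpM2l // ltW.
    have := mulr_ge0 (ltW d0) (mulr_ge0 c0 (ltW pn)).
    move: dv err2; move: (v X) (2 ^+ n) (2 ^+ a) => y p z; clear; lra.
  exists X'.
    (* As [2 * 4 ^ a <= k <= #|X|], the additive imbalance costs at most half of [X], so a quarter
       survives. *)
    have h2 : (#|X| <= 4 * #|X'|)%N by lia.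
    by apply: leq_trans mX _; rewrite expnS mulnA (mulnC _ 4) leq_mul2r h2 orbT.
  apply: le_trans vX' _; rewrite exprS -mulrA ler_wpM2l //.
  by rewrite /kap; have := gap_ratio_le R; lra.
have [X mX vX] := step l (leqnn _).
have kX : (k <= #|X|)%N.
  by rewrite -(@leq_pmul2r (4 ^ l)) ?expn_gt0 //; apply: leq_trans mX.
have := le_trans (vlow X kX) vX; rewrite ler_pM2r //; lra.
Qed.

(** * Asymptotics *)

Lemma horner_nat_le (p : {poly nat}) (m : nat) :
  (0 < m)%N -> (p.[m] <= p.[1%N] * m ^ size p)%N.
Proof.
move=> m0; rewrite !horner_coef big_distrl /=; apply: leq_sum => i _.
rewrite expr1n mulr1 natrXE -[(_ * _)%R]/(_ * _)%N leq_mul2l leq_pexp2l ?orbT //.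
exact: ltnW.
Qed.

(** The shift by 5 matches the exponent [e = 2 ^ (l - 5)] of the final choice of parameters; the
    quadratic bound [sq] suffices. *)
Lemma linear_le_exp2 (K : nat) :
  exists l0 : nat, forall l, (l0 <= l)%N -> (K * l.+1 <= 2 ^ (l - 5))%N.
Proof.
have sq n : (n * n <= 2 * 2 ^ n)%N.
  case: n => [|[|[|]]] //; elim=> // n IH; rewrite expnS; nia.
exists (14 * K + 6)%N => l hl.
have -> : l.+1 = ((l - 5) + 6)%N by lia.
have : (14 * K + 1 <= l - 5)%N by lia.
move: (l - 5)%N (sq (l - 5)%N) => j hj jK; nia.
Qed.

(** The exponent is the one for which [2 ^ (d * l)] raised to it equals the inverse of [kap ^+ l];
    the proof compares logarithms. *)
Lemma powR_ratio_bound (R : realType) (kap : R) (m l d : nat) :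
  0 < kap -> kap <= 1 -> (0 < m)%N -> (0 < d)%N -> (m <= 2 ^ (d * l))%N ->
  kap ^+ l <= 1 / (m%:R `^ (- ln kap / (d%:R * ln 2))).
Proof.
move=> k0 k1 m0 d0 ml.
have ln2 : 0 < ln 2 :> R by rewrite ln_gt0 // ltr1n.
have mR : 0 < m%:R :> R by rewrite ltr0n.
have dR : 0 < d%:R :> R by rewrite ltr0n.
have lnm : ln m%:R <= (d * l)%:R * ln 2 :> R.
  rewrite mulr_natl -lnXn // ler_ln ?posrE ?exprn_gt0 //.
  by rewrite -natrX ler_nat.
have lnk : ln kap <= 0 by rewrite ln_le0.
rewrite ler_pdivlMr ?powR_gt0 // /powR gt_eqF // -[X in X ^+ l]lnK ?posrE //.
rewrite -expRM_natl -expRD -[leRHS]expR0 ler_expR.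
have ln20 : d%:R * ln 2 != 0 :> R by rewrite mulf_neq0 ?gt_eqF.
have : - ln kap / (d%:R * ln 2) * ln m%:R <= - ln kap / (d%:R * ln 2) * ((d * l)%:R * ln 2).
  by rewrite ler_wpM2l // divr_ge0 ?oppr_ge0 // mulr_ge0 // ltW.
have -> : - ln kap / (d%:R * ln 2) * ((d * l)%:R * ln 2) = - (l%:R * ln kap).
  by rewrite natrM; field; rewrite !gt_eqF.
lra.
Qed.

Lemma dyadic_scale (d l0 m : nat) :
  (0 < d)%N -> (2 ^ (d * l0) <= m)%N ->
  exists l, [/\ (l0 <= l)%N, (2 ^ (d * l) <= m)%N & (m < 2 ^ (d * l.+1))%N].
Proof.
move=> d0 hm; have m0 : (0 < m)%N by apply: leq_trans hm; rewrite expn_gt0.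
have d1 : (1 < 2 ^ d)%N by rewrite -{1}(expn0 2) ltn_exp2l.
have /andP[lm ml] := trunc_log_bounds d1 m0.
exists (trunc_log (2 ^ d) m); rewrite !expnM; split=> //.
by rewrite -ltnS -(ltn_exp2l _ _ d1); apply: leq_ltn_trans ml; rewrite -expnM.
Qed.

(** This serves to make the threshold error [2 ^+ a] negligible: the ratio [2 ^+ l] of [2 ^+ n] to
    [2 ^+ a] outgrows the loss [kap ^+ l], because [2 * kap] is at least [3 / 2]. *)
Lemma exp_grows (R : realType) (g kap : R) :
  0 < g -> 3 / 4 <= kap ->
  exists l0 : nat, forall l, (l0 <= l)%N -> 1 <= g * kap ^+ l * 2 ^+ l.
Proof.
move=> g0 k34; exists (Num.bound (2 * g^-1)) => l hl.
have lR : 2 * g^-1 <= l%:R.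
  apply: le_trans (ltW (archi_boundP _)) _; first by rewrite mulr_ge0 // invr_ge0 ltW.
  by rewrite ler_nat.
have hk : 1 + 2^-1 <= kap * 2 by lra.
have hl2 := @bernoulli_ge R 2^-1 l ltac:(lra).
have : (1 + 2^-1) ^+ l <= (kap * 2) ^+ l by rewrite lerXn2r ?nnegrE //; lra.
rewrite -mulrA -exprMn => hk2.
have hg : g * (l%:R * 2^-1) <= g * (kap * 2) ^+ l.
  by rewrite ler_wpM2l //; [exact: ltW | lra].
by apply: le_trans hg; rewrite mulrA ler_pdivlMr // mul1r -ler_pdivrMl // mulrC.
Qed.

(** The number of queries is only exponential in [l], whereas the failure probability of a single
    query is doubly exponentially small in [l]. *)
Lemma query_bound_negligible (R : realType) (g kap : R) (p : {poly nat}) (d : nat) :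
  0 < g -> 3 / 4 <= kap ->
  exists l0 : nat, forall l m, (l0 <= l)%N -> (0 < m)%N -> (m < 2 ^ (d * l.+1))%N ->
    8 * (p.[m].+2%:R * (2 / 2 ^+ (2 ^ (l - 5)))) <= g * kap ^+ l :> R.
Proof.
move=> g0 k34; set C : R := (p.[1%N] + 2)%N%:R.
pose r := Num.bound (g^-1 * (16 * C)).
have hr : 16 * C <= g * 2 ^+ r.
  rewrite -ler_pdivrMl //; apply: le_trans (ltW (archi_boundP _)) _.
    by rewrite mulr_ge0 ?invr_ge0 ?(ltW g0) // mulr_ge0.
  by rewrite -/r -natrX ler_nat ltnW // ltn_expl.
have [l0 hl0] := linear_le_exp2 (r + d * size p + 1).
exists l0 => l m /hl0 lexp m0 ml.
have hq : p.[m].+2%:R <= C * 2 ^+ (d * size p * l.+1).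
  rewrite /C -natrX -natrM ler_nat; have hpm := horner_nat_le p m0.
  have hms : (m ^ size p <= 2 ^ (d * size p * l.+1))%N.
    rewrite mulnAC expnM; case: (size p) => [|s]; rewrite ?expn0 //.
    by rewrite leq_exp2r // ltnW.
  have : (0 < 2 ^ (d * size p * l.+1))%N by rewrite expn_gt0.
  move: hpm hms; move: (2 ^ _)%N (m ^ _)%N p.[m] p.[1%N] => x y z t; clear; nia.
have h2 : 2 ^+ r * 2 ^+ (d * size p * l.+1) * 2 ^+ l <= 2 ^+ (2 ^ (l - 5)) :> R.
  rewrite -!exprD ler_eXn2l ?ltr1n //; apply: leq_trans lexp.
  by move: (d * size p)%N => s; clear; nia.
have e0 : 0 < 2 ^+ (2 ^ (l - 5)) :> R by rewrite exprn_gt0.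
have hX : 1 <= kap ^+ l * 2 ^+ l by rewrite -exprMn exprn_ege1 //; lra.
have K0 : 0 <= kap ^+ l by rewrite exprn_ge0 //; lra.
have P0 : 0 <= 2 ^+ (d * size p * l.+1) :> R by rewrite exprn_ge0.
have Y0 : 0 <= 2 ^+ r :> R by rewrite exprn_ge0.
move: (2 ^+ (2 ^ (l - 5))) (2 ^+ (d * size p * l.+1)) hq h2 e0 P0 => E P hq h2 E0 P0.
clearbody r C; move: (kap ^+ l) (2 ^+ l) (2 ^+ r) C hX K0 Y0 hr hq h2 => K X Y c hX K0 Y0 hr hq h2.
rewrite mulrCA mulrA mulrA ler_pdivrMr //.
have -> : p.[m].+2%:R * 8 * 2 = 16 * p.[m].+2%:R :> R by ring.
have gYP : 0 <= g * Y * P by rewrite !mulr_ge0 // ltW.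
apply: (@le_trans _ _ (16 * (c * P))); first by rewrite ler_wpM2l.
apply: (@le_trans _ _ (g * Y * P)); first by rewrite mulrA ler_wpM2r.
apply: (@le_trans _ _ (g * Y * P * (K * X))); first by rewrite ler_peMr.
have -> : g * Y * P * (K * X) = g * K * (Y * P * X) by ring.
by rewrite ler_wpM2l // mulr_ge0 // ltW.
Qed.

(** * Choice of the constants and parameters *)

Theorem theorem4p2 (R : realType) :
  exists eps gamma : R,
    [/\ 0 < eps, 0 < gamma
      & forall M : (forall m : nat, mechanism R m),
          poly_queries M ->
          exists m0 : nat, forall m : nat, (m0 <= m)%N ->
            ~ (approx_midr eps (M m) /\
               exists c : R, 1 / (m%:R `^ gamma) < c /\ achieves c (M m))].
Proof.
have gap0 := gap_ratio_gt0 R; have gap1 := gap_ratio_le R.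
pose g : R := gap_ratio R / 10; pose kap : R := 1 - gap_ratio R / 2.
have g0 : 0 < g by rewrite divr_gt0.
have g1 : g <= 1 by rewrite /g; lra.
have kap34 : 3 / 4 <= kap by rewrite /kap; lra.
have kap0 : 0 < kap by lra.
have kap1 : kap < 1 by rewrite /kap; lra.
(* The 20 comes from [m < 2 ^ (10 * l.+1) <= 2 ^ (20 * l)], with [l] the number of splits. *)
exists g, (- ln kap / (20%:R * ln 2)); split => //.
  by rewrite divr_gt0 ?oppr_gt0 ?mulr_gt0 ?ln_gt0 ?ltr1n // ln_lt0 // kap0.
move=> M [p hp].
have [l1 hl1] := query_bound_negligible p 10 g0 kap34.
have [l2 hl2] := exp_grows g0 kap34.
(* The 5 ensures [5 <= l], so that the subtraction in [2 ^ (l - 5)] is not truncated. *)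
exists (2 ^ (10 * maxn 5 (maxn l1 l2)))%N => m hm [HM [c [hc Hc]]].
have m0 : (0 < m)%N by apply: leq_trans hm; rewrite expn_gt0.
have [l [+ lm ml]] := dyadic_scale (isT : 0 < 10)%N hm.
rewrite !geq_max => /and3P[l5 /hl1 /(_ m0 ml) tau8 /hl2 grow].
have ck : kap ^+ l < c.
  apply: le_lt_trans hc; apply: powR_ratio_bound => //; first exact: ltW.
  by apply: leq_trans (ltnW ml) _; rewrite leq_exp2l //; move: l5; clear; lia.
suff : c <= kap ^+ l by rewrite leNgt ck.
have tau1 : p.[m].+2%:R * (2 / 2 ^+ (2 ^ (l - 5))) < 1 :> R.
  have : g * kap ^+ l <= 1 * 1 by rewrite ler_pM ?exprn_ge0 ?exprn_ile1 // ltW.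
  by move: tau8; move: (_ * (2 / _)) (g * _) => x y; clear; lra.
have pow4 x : (4 ^ x = 2 ^ (2 * x))%N by rewrite expnM.
(* With [m] between [2 ^ (10 * l)] and [2 ^ (10 * l.+1)], the bound is [k = 2 ^ (8 * l)], leaving
   room for [l] quarterings. The threshold [2 ^ (6 * l)] lies below [k] but exceeds [N], at least
   the square root of [m], by the factor [e = 2 ^ (l - 5)]. *)
apply: (@approximation_ratio_le R m (3 * l) (4 * l) (2 ^ (5 * l.+1))
  (2 ^ (l - 5)) p.[m] l (M m) c) => //.
- by rewrite !pow4 -expnD (leq_trans _ lm) // leq_exp2l //; clear; lia.
- rewrite [X in (_ <= 4 ^ X)%N]mulSn expnD leq_mul2r; apply/orP; right.
  by rewrite (@leq_trans (4 ^ 1)) // leq_exp2l //; move: l5; clear; lia.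
- by rewrite expn_gt0.
- by rewrite -expnD pow4; congr (2 ^ _)%N; move: l5; clear; lia.
- by apply: leq_trans (ltnW ml) _; rewrite -expnM leq_exp2l //; clear; lia.
- move=> f w vf; apply: hp => //; apply: leq_trans lm.
  by rewrite pow4 leq_exp2l //; clear; lia.
- by apply: le_trans tau8 _; rewrite ler_wpM2l ?ltW.
rewrite [in leRHS]mulSn exprD mulrA ler_peMl ?exprn_ge0 //; apply: le_trans grow _.
by rewrite ler_wpM2r ?exprn_ge0 // ler_wpM2l //; exact: ltW.
Qed.
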